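(* Let $\mathcal{C}^\circ$ and $\widetilde{\mathcal{C}}^\circ$ be admissible cubic parabolas of $\mathbb{L}$, the proper parts of the chains $\mathcal{C}$ and $\widetilde{\mathcal{C}}$, respectively. Then the chains $\mathcal{C}$ and $\widetilde{\mathcal{C}}$ have the same improper point if, and only if, the extended curves $\mathcal{C}^+$ and $\widetilde{\mathcal{C}}^+$ have contact of third order at $f=\mathbb{R}(0,0,0,1)$.
   Context: Let $\mathbb{L}=\mathbb{R}[X]/\langle X^3\rangle$, a 3-dimensional commutative local real algebra with basis $1,\varepsilon,\varepsilon^2$, where $\varepsilon=X+\langle X^3\rangle$, so $\varepsilon^3=0$. Its maximal ideal is $N=\mathbb{R}\varepsilon+\mathbb{R}\varepsilon^2$, and $\mathbb{R}$ is regarded as a subring of $\mathbb{L}$. The projective line $\mathbb{P}(\mathbb{L})$ over $\mathbb{L}$ is the set of all cyclic submodules $\mathbb{L}(u,v)\subset\mathbb{L}^2$ such that $u$ or $v$ is a unit of $\mathbb{L}$. The real projective line $\mathbb{P}(\mathbb{R})$ is embedded in it by $\mathbb{R}(x,y)\mapsto\mathbb{L}(x,y)$. The chains are the images of $\mathbb{P}(\mathbb{R})\subset\mathbb{P}(\mathbb{L})$ under the natural right action of $\mathrm{GL}_2(\mathbb{L})$ on $\mathbb{L}^2$. A proper point of $\mathbb{P}(\mathbb{L})$ is one of the form $\mathbb{L}(z,1)$ with $z\in\mathbb{L}$, and it is identified with $z\in\mathbb{L}$. Every other point has the form $\mathbb{L}(1,z)$ with $z\in N$ and is called improper. Each chain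 contains exactly one improper point. The proper part $\mathcal{C}^\circ$ of a chain $\mathcal{C}$ is the set of its proper points, regarded as a subset of the real affine 3-space $\mathbb{L}$. The affine space $\mathbb{L}$ is embedded in its projective closure $\mathbb{P}_3(\mathbb{R})$ by identifying $x_1+x_2\varepsilon+x_3\varepsilon^2\in\mathbb{L}$ with $\mathbb{R}(1,x_1,x_2,x_3)$. The plane at infinity is $\Phi: x_0=0$. A cubic parabola of $\mathbb{L}$ is the affine part of a twisted cubic of $\mathbb{P}_3(\mathbb{R})$ that has $\Phi$ as an osculating plane (equivalently, an image of $\{t+t^2\varepsilon+t^3\varepsilon^2\mid t\in\mathbb{R}\}$ under a bijective real affine transformation of $\mathbb{L}$). A cubic parabola is called admissible if it is the proper part of a chain. If $\mathcal{C}^\circ$ is a cubic parabola, then $\mathcal{C}^+\subset\mathbb{P}_3(\mathbb{R})$ denotes the unique twisted cubic containing $\mathcal{C}^\circ$. Contact of order $m$ is understood as contact of order at least $m$: two twisted cubics have contact of order $m$ at a point $f$ if both pass through $f$ and, in an affine chart around $f$, they admit smooth regular local parametrizations $g_1,g_2$ with $g_1(0)=g_2(0)=f$ whose derivatives at $0$ agree up to and including order $m$. *)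

(* Defs.v *)
From HB Require Import structures.
From mathcomp Require Import all_boot all_order all_algebra.
From mathcomp Require Import qpoly.
From mathcomp Require Import all_classical all_reals all_analysis.

Set Implicit Arguments.
Unset Strict Implicit.
Unset Printing Implicit Defensive.

Import Order.TTheory GRing.Theory Num.Theory.
Import numFieldNormedType.Exports.

Local Open Scope classical_set_scope.
Local Open Scope ring_scope.

(* The algebra R[X]/<X^3>. The element x1 + x2 eps + x3 eps^2 is represented
   by its remainder z : {poly R}, so x1 = z`_0, x2 = z`_1 and x3 = z`_2. *)
Notation LL R := {poly %/ ('X^3 : {poly R})}.

Definition cyclic_submodule (A : comNzRingType) (n : nat) (v : 'rV[A]_n) :
  set 'rV[A]_n := [set a *: v | a in setT].

Definition vec2 (A : Type) (u v : A) : 'rV[A]_2 :=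
  \row_(i < 2) if i == 0 then u else v.

Section Chains.
Variable R : realType.

Definition projective_line : set (set 'rV[LL R]_2) :=
  [set p | exists u v : LL R, (u \is a GRing.unit \/ v \is a GRing.unit) /\
                              p = cyclic_submodule (vec2 u v)].

(* R(x,y) |-> LL(x,y); [qpolyC] is the inclusion of R into LL R. *)
Definition real_line : set (set 'rV[LL R]_2) :=
  [set p | exists x y : R, (x != 0 \/ y != 0) /\
     p = cyclic_submodule (vec2 (qpolyC 'X^3 x) (qpolyC 'X^3 y))].

Definition GL2_act (A : 'M[LL R]_2) (p : set 'rV[LL R]_2) : set 'rV[LL R]_2 :=
  [set v *m A | v in p].

Definition is_chain (C : set (set 'rV[LL R]_2)) : Prop :=
  exists2 A : 'M[LL R]_2, A \in unitmx & C = [set GL2_act A p | p in real_line].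

Definition proper_point (z : LL R) : set 'rV[LL R]_2 :=
  cyclic_submodule (vec2 z 1).

Definition is_improper (p : set 'rV[LL R]_2) : Prop :=
  projective_line p /\ ~ exists z : LL R, p = proper_point z.

Definition proper_part (C : set (set 'rV[LL R]_2)) : set (LL R) :=
  [set z | C (proper_point z)].

End Chains.

Section TwistedCubics.
Variable R : realType.

(* A point of P_3(R) is the line [cyclic_submodule x] with x != 0. *)

Definition std_cubic (s t : R) : 'rV[R]_4 :=
  \row_(i < 4) (s ^+ (3 - i) * t ^+ i).

Definition twisted_cubic (K : set (set 'rV[R]_4)) : Prop :=
  exists2 M : 'M[R]_4, M \in unitmx &
    K = [set p | exists s t : R, (s != 0 \/ t != 0) /\
                 p = cyclic_submodule (std_cubic s t *m M)].

(* The affine chart of P_3(R) given by a linear form w (the complement of the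
   plane w = 0) is identified with the affine hyperplane x *m w = 1 of R^4:
   each point off the plane has exactly one representative there.
   In this chart, g restricted to some interval ]-d, d[ is a smooth regular
   parametrization of a neighbourhood of the point g 0 in K. *)
Definition local_parametrization (K : set (set 'rV[R]_4)) (w : 'cV[R]_4)
    (g : R -> 'rV[R]_4) : Prop :=
  exists (d : R) (U : set 'rV[R]_4),
    [/\ 0 < d,
        forall (n : nat) (t : R), `|t| < d -> derivable (derive1n n g) t 1,
        forall t : R, `|t| < d -> derive1 g t != 0,
        forall t1 t2 : R, `|t1| < d -> `|t2| < d -> g t1 = g t2 -> t1 = t2 &
        open U /\
        [set g t | t in [set t | `|t| < d]] =
          U `&` [set x | x *m w = 1%:M /\ K (cyclic_submodule x)]].

(* Contact of order at least m. *)
Definition contact (m : nat) (K1 K2 : set (set 'rV[R]_4))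
    (f : set 'rV[R]_4) : Prop :=
  exists (w : 'cV[R]_4) (g1 g2 : R -> 'rV[R]_4),
    [/\ local_parametrization K1 w g1, local_parametrization K2 w g2,
        cyclic_submodule (g1 0) = f, cyclic_submodule (g2 0) = f &
        forall k : nat, (k <= m)%N -> derive1n k g1 0 = derive1n k g2 0].

(* The plane x *m p = 0 contains a point g 0 of K together with the directions
   of the first two derivatives there; as g takes its values in an affine
   hyperplane of R^4, the derivatives are points at infinity of that chart. *)
Definition osculating_plane (p : 'cV[R]_4) (K : set (set 'rV[R]_4)) : Prop :=
  p != 0 /\
  exists (w : 'cV[R]_4) (g : R -> 'rV[R]_4), local_parametrization K w g /\
    forall k : nat, (k <= 2)%N -> derive1n k g 0 *m p = 0.

(* The plane x0 = 0. *)
Definition plane_at_infinity : 'cV[R]_4 := delta_mx 0 0.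

Definition embed (z : LL R) : set 'rV[R]_4 :=
  cyclic_submodule (\row_(i < 4) [:: 1; z`_0; z`_1; z`_2]`_i).

Definition cubic_parabola (S : set (LL R)) : Prop :=
  exists K : set (set 'rV[R]_4),
    [/\ twisted_cubic K, osculating_plane plane_at_infinity K &
        S = [set z | K (embed z)]].

Definition cubic_extension (S : set (LL R)) (K : set (set 'rV[R]_4)) : Prop :=
  twisted_cubic K /\ [set embed z | z in S] `<=` K.

Definition point_f : set 'rV[R]_4 := cyclic_submodule (delta_mx 0 ord_max).

End TwistedCubics.

Arguments point_f R : clear implicits.

(* Main.v *)
From HB Require Import structures.
Require Import Defs.
From mathcomp Require Import all_boot all_order all_algebra.
From mathcomp Require Import qpoly ring lra.
From mathcomp Require Import all_classical all_reals all_analysis.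

(** The proof attaches two real invariants to a chain and shows that both the
    improper point and the 3-jet at [f] are equivalent to them.

    Write LL for the algebra and N for its maximal ideal.  Taking the inverse
    of the residue matrix as a change of the real parameters and dividing by
    a unit, any chain becomes the set of points LL(s v + t c, s m + t) with v
    in 1 + N and m, c in N ([chain_normal_form]).  Its improper point is
    LL(v, m) = LL(1, n) with n = m / v = n1 eps + n2 eps^2, so two chains have
    the same improper point exactly when n1 and n2 agree
    ([improper_point_eq]).

    The points with parameters (t, 1) form a curve whose coordinates x1, x2
    and x3 are polynomials in t with the leading terms t, - n1 t^2 and
    n1^2 t^3.  A twisted cubic has no infinite planar subset, which forces
    n1 <> 0
    ([affine_curve_nonplanar]).  A twisted cubic is also cut out by three
    quadrics, and a quadric with infinitely many points on another twisted
    cubic contains it; so there is only one twisted cubic through the curve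
    ([cubic_of_sub]), and the extended curve is the explicit cubic of
    [cubic_extension_normal].  Besides m := n1 and k := n2 / n1, its matrix
    [normal_mx] involves four further coefficients.

    Near f the quotient T of the coordinates X2 and X3 is a local parameter,
    and modulo T^4 the curve is (- m T^3 : T^2 + k T^3 : T : 1): the four
    other coefficients drop out.  [canonical_parametrization] gives an honest
    local parametrization with this 3-jet, so equal invariants imply contact
    of order three.  For the converse the parametrizations realizing the
    contact are arbitrary, and [jet_invariants] recovers m and k from the
    3-jet of any of them, by differentiating the quadratic equations of the
    curve three times. *)

Set Implicit Arguments.
Unset Strict Implicit.
Unset Printing Implicit Defensive.

Import Order.TTheory GRing.Theory Num.Theory.
Import numFieldNormedType.Exports.

Local Open Scope classical_set_scope.
Local Open Scope ring_scope.

(** * Lines, coordinates and twisted cubics *)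

Section Lines.

Lemma mem_cyclic_submodule (A : comNzRingType) n (v : 'rV[A]_n) :
  cyclic_submodule v v.
Proof. by exists 1 => //; rewrite scale1r. Qed.

Lemma cyclic_submoduleZ (A : comUnitRingType) n (u : A) (v : 'rV[A]_n) :
  u \is a GRing.unit -> cyclic_submodule (u *: v) = cyclic_submodule v.
Proof.
move=> Uu; apply/seteqP; split=> _ [a _ <-].
  by exists (a * u) => //; rewrite scalerA.
by exists (a / u) => //; rewrite scalerA divrK.
Qed.

Lemma cyclic_submodule_scaled (F : fieldType) n (x y : 'rV[F]_n) : x != 0 ->
  cyclic_submodule x = cyclic_submodule y -> exists2 c, c != 0 & x = c *: y.
Proof.
move=> x0 xy; have := mem_cyclic_submodule x; rewrite xy => -[c _ cE].
exists c => //; apply: contraNneq x0 => c0.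
by rewrite -cE c0 scale0r.
Qed.

End Lines.

Local Notation "x ``_ k" := (x 0 (inord k)) (at level 3, k at level 2, left associativity, format "x ``_ k").

Section Coordinates.
Variable R : nzRingType.

Definition row4 (a b c d : R) : 'rV[R]_4 := \row_(i < 4) [:: a; b; c; d]`_i.

Lemma row4E a b c d k : (k < 4)%N -> (row4 a b c d)``_k = [:: a; b; c; d]`_k.
Proof. by move=> k4; rewrite mxE inordK. Qed.

Lemma sum4 (V : nmodType) (F : 'I_4 -> V) :
  \sum_(i < 4) F i = F (inord 0) + F (inord 1) + F (inord 2) + F (inord 3).
Proof.
rewrite !big_ord_recl big_ord0 addr0 -!addrA.
by congr (F _ + (F _ + (F _ + F _))); apply/val_inj; rewrite /= inordK.
Qed.

Lemma row4P (x y : 'rV[R]_4) :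
  [/\ x``_0 = y``_0, x``_1 = y``_1, x``_2 = y``_2 & x``_3 = y``_3] ->
  x = y.
Proof.
move=> [h0 h1 h2 h3]; apply/rowP => i.
by rewrite -(inord_val i); case: i => -[|[|[|[|]]]].
Qed.

Lemma coordZ c (x : 'rV[R]_4) k : (c *: x)``_k = c * x``_k.
Proof. by rewrite mxE. Qed.

Lemma mul_row4 n (x : 'rV[R]_4) (M : 'M[R]_(4, n)) j :
  (x *m M) 0 j = x``_0 * M (inord 0) j + x``_1 * M (inord 1) j
               + x``_2 * M (inord 2) j + x``_3 * M (inord 3) j.
Proof. by rewrite mxE sum4. Qed.

End Coordinates.

Section TwistedCubics.
Variable R : realType.
Implicit Types (M N : 'M[R]_4) (x y : 'rV[R]_4) (s t : R).

Definition cubic_of M : set (set 'rV[R]_4) :=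
  [set p | exists s t : R, (s != 0 \/ t != 0) /\
                 p = cyclic_submodule (std_cubic s t *m M)].

(** The 2-by-2 minors of the matrix with rows (y0, y1, y2) and (y1, y2, y3). *)
Definition on_quadrics y : Prop :=
  [/\ y``_0 * y``_2 = y``_1 ^+ 2, y``_1 * y``_3 = y``_2 ^+ 2
    & y``_0 * y``_3 = y``_1 * y``_2].

Lemma std_cubicE s t : std_cubic s t = row4 (s ^+ 3) (s ^+ 2 * t) (s * t ^+ 2) (t ^+ 3).
Proof.
by apply: row4P; rewrite !mxE !inordK //= ?subSS ?subn0 ?subnn ?expr0 ?expr1 ?mulr1 ?mul1r.
Qed.

Lemma std_cubic_neq0 s t : s != 0 \/ t != 0 -> std_cubic s t != 0.
Proof.
move=> st; apply/eqP => /rowP st0.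
have := st0 (inord 0); have := st0 (inord 3).
rewrite std_cubicE !row4E //= !mxE => /eqP; rewrite expf_eq0 /= => /eqP t0.
move=> /eqP; rewrite expf_eq0 /= => /eqP s0.
by case: st; rewrite ?s0 ?t0 eqxx.
Qed.

Lemma std_cubic_quadrics s t : on_quadrics (std_cubic s t).
Proof. by rewrite std_cubicE /on_quadrics !row4E //=; split; ring. Qed.

Lemma on_quadricsZ c y : on_quadrics y -> on_quadrics (c *: y).
Proof.
move=> [q1 q2 q3]; rewrite /on_quadrics !mxE; split.
- by rewrite mulrACA q1; ring.
- by rewrite mulrACA q2; ring.
- by rewrite mulrACA q3; ring.
Qed.

Lemma on_quadrics_std y : y != 0 -> on_quadrics y ->
  exists s t c, [/\ s != 0 \/ t != 0, c != 0 & std_cubic s t = c *: y].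
Proof.
move=> y0 [q1 q2 q3]; have [y00|y00] := eqVneq y``_0 0.
  have y10 : y``_1 = 0 by apply/eqP; rewrite -sqrf_eq0 -q1 y00 mul0r.
  have y20 : y``_2 = 0 by apply/eqP; rewrite -sqrf_eq0 -q2 y10 mul0r.
  have y30 : y``_3 != 0.
    apply: contra_neq y0 => y30.
    by apply: row4P; rewrite y00 y10 y20 y30 !mxE.
  exists 0, 1, (y``_3)^-1; split; [by right; rewrite oner_eq0| by rewrite invr_eq0|].
  rewrite std_cubicE; apply: row4P; rewrite !row4E //= !(mxE, y00, y10, y20).
  by split; rewrite ?mulVf //; ring.
exists y``_0, y``_1, (y``_0 ^+ 2); split; [by left | by rewrite expf_neq0|].
rewrite std_cubicE; apply: row4P; rewrite !coordZ !row4E //=.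
split.
- by ring.
- by [].
- by rewrite -q1; ring.
- by rewrite exprS -q1 !mulrA [_ * y``_0]mulrC -mulrA -q3; ring.
Qed.

Lemma mulmx_unit_eq0 n (x : 'rV[R]_n) (M : 'M[R]_n) : M \in unitmx -> (x *m M == 0) = (x == 0).
Proof.
move=> UM; apply/eqP/eqP => [xM0|->]; last by rewrite mul0mx.
by rewrite -[x](mulmxK UM) xM0 mul0mx.
Qed.

(** The quadrics determine the cubic: if y0 <> 0 then (y0, y1) are homogeneous
    parameters of y, and y0 = 0 leaves only the point with parameters (0, 1). *)
Lemma cubic_ofP M y : M \in unitmx -> y != 0 ->
  cubic_of M (cyclic_submodule (y *m M)) <-> on_quadrics y.
Proof.
move=> UM y0; split=> [[s [t [st e]]]|].
  have [|c c0 yE] := cyclic_submodule_scaled _ e; first by rewrite mulmx_unit_eq0.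
  have -> : y = c *: std_cubic s t.
    by rewrite -[y](mulmxK UM) yE -scalemxAl mulmxK.
  exact/on_quadricsZ/std_cubic_quadrics.
move=> /(on_quadrics_std y0) [s [t [c [st c0 e]]]].
by exists s, t; split => //; rewrite e -scalemxAl cyclic_submoduleZ // unitfE.
Qed.

Lemma poly_eq0_inj (P : {poly R}) (u : nat -> R) : injective u ->
  (forall r, P.[u r] = 0) -> P = 0.
Proof.
move=> uI Pu; have [->//|P0] := eqVneq P 0.
have Pr : all (root P) (map u (iota 0 (size P))).
  by apply/allP => _ /mapP[r _ ->]; rewrite rootE Pu.
have ur : uniq (map u (iota 0 (size P))) by rewrite map_inj_uniq // iota_uniq.
by have := max_poly_roots P0 Pr ur; rewrite size_map size_iota ltnn.
Qed.

(** At most one of the points has parameters (0, 1); going to an index range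
    beyond it makes one inhomogeneous parameter available for all points, so
    that statements about infinitely many points become statements about the
    roots of a polynomial in one variable. *)
Lemma affine_parameters M (p : nat -> set 'rV[R]_4) : M \in unitmx ->
  injective p -> (forall r, cubic_of M (p r)) ->
  exists (u : nat -> R) (e : nat -> nat), injective u /\
    forall r, p (e r) = cyclic_submodule (std_cubic 1 (u r) *m M).
Proof.
move=> UM pI pM.
pose inf r := p r = cyclic_submodule (std_cubic 0 1 *m M).
have [e eI einf] : exists2 e : nat -> nat, injective e & forall r, ~ inf (e r).
  have [[r0 r0inf]|noinf] := pselect (exists r, inf r); last first.
    by exists id => // r rinf; apply: noinf; exists r.
  exists (fun r => r0 + r.+1)%N => [r1 r2 /addnI [] //|r rinf].
  have /pI /eqP : p (r0 + r.+1)%N = p r0 by rewrite rinf r0inf.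
  by rewrite -{2}(addn0 r0) eqn_add2l.
have /choice[u uP] : forall r, exists u, p (e r) = cyclic_submodule (std_cubic 1 u *m M).
  move=> r; have [s [t [st pE]]] := pM (e r).
  have [s0|s0] := eqVneq s 0.
    have t0 : t != 0 by case: st => //; rewrite s0 eqxx.
    case: (einf r); rewrite /inf pE.
    have -> : std_cubic s t = t ^+ 3 *: std_cubic 0 1.
      rewrite s0 !std_cubicE; apply: row4P; rewrite !coordZ !row4E //=.
      by split; ring.
    by rewrite -scalemxAl cyclic_submoduleZ // unitfE expf_neq0.
  exists (t / s); rewrite pE.
  have -> : std_cubic s t = s ^+ 3 *: std_cubic 1 (t / s).
    rewrite !std_cubicE; apply: row4P; rewrite !coordZ !row4E //=.
    by split; field.
  by rewrite -scalemxAl cyclic_submoduleZ // unitfE expf_neq0.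
exists u, e; split=> // r1 r2 u12.
by apply/eI/pI; rewrite !uP u12.
Qed.

(** The linear form given by column [j] of [M], restricted to the standard
    cubic in the inhomogeneous parameter. *)
Definition pullback_poly n (M : 'M[R]_(4, n)) j : {poly R} := \poly_(i < 4) M (inord i) j.

Lemma pullback_polyE n (M : 'M[R]_(4, n)) j t :
  (pullback_poly M j).[t] = (std_cubic 1 t *m M) 0 j.
Proof.
rewrite horner_poly sum4 mul_row4 std_cubicE !row4E //= !inordK //.
by ring.
Qed.

(** A linear form pulls back to a polynomial having the transformed form as its
    coefficients; infinitely many roots make all of them vanish. *)
Lemma cubic_of_nonplanar M (p : nat -> set 'rV[R]_4) (a : 'cV[R]_4) :
  M \in unitmx -> injective p -> (forall r, cubic_of M (p r)) ->
  (forall r x, p r = cyclic_submodule x -> x *m a = 0) -> a = 0.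
Proof.
move=> UM pI pM pa; have [u [e [uI uP]]] := affine_parameters UM pI pM.
have P0 : pullback_poly (M *m a) 0 = 0.
  apply: (poly_eq0_inj uI) => r; rewrite pullback_polyE mulmxA.
  by rewrite (pa _ _ (uP r)) mxE.
rewrite -[a](mulKmx UM); suff -> : M *m a = 0 by rewrite mulmx0.
apply/matrixP => i j; rewrite (ord1 j) [RHS]mxE.
have := congr1 (fun P : {poly R} => P`_i) P0.
by rewrite coef_poly ltn_ord inord_val coef0.
Qed.

(** Each quadric through the second cubic pulls back along the first to a
    polynomial with infinitely many roots, hence to 0.  By symmetry two twisted
    cubics with infinitely many common points coincide. *)
Lemma cubic_of_sub M M' (p : nat -> set 'rV[R]_4) :
  M \in unitmx -> M' \in unitmx -> injective p ->
  (forall r, cubic_of M (p r)) -> (forall r, cubic_of M' (p r)) ->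
  cubic_of M `<=` cubic_of M'.
Proof.
move=> UM UM' pI pM pM'; have [u [e [uI uP]]] := affine_parameters UM pI pM.
pose N := M *m invmx M'; pose P k := pullback_poly N (inord k).
have NM' y : y *m M = y *m N *m M' by rewrite -!mulmxA mulVmx // mulmx1.
have UN : N \in unitmx by rewrite unitmx_mul UM unitmx_inv.
have qu r : on_quadrics (std_cubic 1 (u r) *m N).
  rewrite -(cubic_ofP UM'); first by rewrite -NM' -uP.
  by rewrite mulmx_unit_eq0 // std_cubic_neq0 //; left; exact: oner_neq0.
have Pu k r : (P k).[u r] = (std_cubic 1 (u r) *m N)``_k by exact: pullback_polyE.
have [q1 q2 q3] : [/\ P 0%N * P 2 = P 1%N ^+ 2, P 1%N * P 3 = P 2 ^+ 2 &
    P 0%N * P 3 = P 1%N * P 2].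
  by split; apply/eqP; rewrite -subr_eq0; apply/eqP; apply: (poly_eq0_inj uI) => r;
     rewrite !hornerE !Pu; have [h1 h2 h3] := qu r; apply/eqP; rewrite subr_eq0 ?h1 ?h2 ?h3.
(* At the point with parameters (0, 1) the quadrics take the values of the
   coefficients of degree 6. *)
have coef6 i j : (P i * P j)`_6 = N (inord 3) (inord i) * N (inord 3) (inord j).
  rewrite coefM !big_ord_recl big_ord0 !coef_poly /= /bump /=.
  by rewrite ?(mul0r, mulr0, add0r, addr0).
move=> _ [s [t [st ->]]]; rewrite NM'; apply/cubic_ofP => //.
  by rewrite mulmx_unit_eq0 // std_cubic_neq0.
have [s0|s0] := eqVneq s 0.
  have -> : std_cubic s t = t ^+ 3 *: row4 0 0 0 1.
    rewrite s0 !std_cubicE; apply: row4P; rewrite !coordZ !row4E //=.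
    by split; ring.
  rewrite -scalemxAl; apply: on_quadricsZ; split; rewrite ?expr2 !mul_row4 !row4E //=;
  by rewrite !(mul0r, add0r, mul1r) -!coef6 ?q1 ?q2 ?q3 ?expr2.
have -> : std_cubic s t = s ^+ 3 *: std_cubic 1 (t / s).
  rewrite !std_cubicE; apply: row4P; rewrite !coordZ !row4E //=.
  by split; field.
rewrite -scalemxAl; apply: on_quadricsZ.
by split; rewrite -?expr2 -!pullback_polyE -!hornerM ?q1 ?q2 ?q3 ?hornerE // expr2 hornerE.
Qed.

End TwistedCubics.

(** * Chains and their improper points *)

Section Algebra.
Variable R : realType.
Implicit Types (x y z : LL R).

Lemma size_mk_monic_X3 : (size (mk_monic ('X^3 : {poly R}))).-1 = 3%N.
Proof. by rewrite mk_monic_Xn size_polyXn. Qed.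

Definition mkLL (a b c : R) : LL R := mk_npoly _ (fun i => [:: a; b; c]`_i).

Lemma mkLLE a b c i : (i < 3)%N -> (mkLL a b c)`_i = [:: a; b; c]`_i.
Proof. by move=> i3; rewrite coef_poly size_mk_monic_X3 i3. Qed.

Lemma LL_eqP x y : x`_0 = y`_0 -> x`_1 = y`_1 -> x`_2 = y`_2 -> x = y.
Proof.
move=> h0 h1 h2; apply/npolyP => i; case: (ltnP i 3) => [|i3].
  by case: i => [|[|[|]]].
by rewrite !big_coef_npoly // size_mk_monic_X3.
Qed.

Lemma coefLLM x y i : (i < 3)%N -> (x * y)`_i = ((x : {poly R}) * (y : {poly R}))`_i.
Proof.
move=> i3; rewrite poly_of_qpolyM; move: (polyn x * polyn y) => p.
by rewrite mk_monic_Xn -Pdiv.RingMonic.take_poly_rmodp coef_take_poly i3.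
Qed.

Lemma coefLLM0 x y : (x * y)`_0 = x`_0 * y`_0.
Proof. by rewrite coefLLM // coefM big_ord_recl big_ord0 addr0. Qed.
Lemma coefLLM1 x y : (x * y)`_1 = x`_0 * y`_1 + x`_1 * y`_0.
Proof. by rewrite coefLLM // coefM !big_ord_recl big_ord0 addr0. Qed.
Lemma coefLLM2 x y : (x * y)`_2 = x`_0 * y`_2 + x`_1 * y`_1 + x`_2 * y`_0.
Proof. by rewrite coefLLM // coefM !big_ord_recl big_ord0 addr0 addrA. Qed.
Lemma coefLLD x y i : (x + y)`_i = x`_i + y`_i.
Proof. by rewrite poly_of_qpolyD coefD. Qed.
Lemma coefLLN x i : (- x)`_i = - x`_i.
Proof. by rewrite -coefN. Qed.
Lemma coefLLC (a : R) i : (qpolyC 'X^3 a)`_i = if i == 0%N then a else 0.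
Proof. by rewrite coefC. Qed.
Lemma coefLL1 i : (1 : LL R)`_i = (i == 0%N)%:R.
Proof. by rewrite coef1. Qed.

Definition coefLLE := (coefLLM0, coefLLM1, coefLLM2, coefLLD, coefLLN, coefLLC, coefLL1).

(** The algebra is local with residue map [z |-> z`_0]; the inverse is the
    geometric series, which stops after the quadratic term. *)
Lemma LL_unitP x : reflect (x`_0 != 0) (x \is a GRing.unit).
Proof.
apply: (iffP idP) => [Ux|x0].
  have := congr1 (fun z : LL R => z`_0) (mulrV Ux).
  rewrite coefLLM0 coefLL1 /= => e; apply/eqP => x0.
  by move/eqP: e; rewrite x0 mul0r eq_sym oner_eq0.
apply/unitrPr; exists (mkLL (x`_0)^-1 (- x`_1 / x`_0 ^+ 2)
   ((x`_1 ^+ 2 - x`_0 * x`_2) / x`_0 ^+ 3)).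
by apply: LL_eqP; rewrite !(coefLLE, mkLLE) //=; field.
Qed.

End Algebra.

Section Chains.
Variable R : realType.
Implicit Types (v c m z : LL R).

Lemma vec2Z (A : comNzRingType) (a u v : A) : a *: vec2 u v = vec2 (a * u) (a * v).
Proof. by apply/rowP => i; rewrite !mxE; case: ifP. Qed.

Lemma vec2_inj (A : Type) (u v u' v' : A) : vec2 u v = vec2 u' v' -> u = u' /\ v = v'.
Proof. by move=> /rowP e; have := e 0; have := e 1; rewrite !mxE. Qed.

Lemma vec2_mul (A : comNzRingType) (u v : A) (M : 'M[A]_2) :
  vec2 u v *m M = vec2 (u * M 0 0 + v * M 1 0) (u * M 0 1 + v * M 1 1).
Proof.
apply/rowP => i; rewrite !mxE !big_ord_recl big_ord0 addr0 !mxE /=.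
have -> : lift ord0 (ord0 : 'I_1) = 1 by apply/val_inj.
by case: ifPn => [/eqP->|]; last by case: i => -[|[]] // h; 
  rewrite (_ : Ordinal h = 1) //; apply/val_inj.
Qed.

Lemma cyclic_vec2_unit (A : comUnitRingType) (u w : A) : w \is a GRing.unit ->
  cyclic_submodule (vec2 u w) = cyclic_submodule (vec2 (u / w) 1).
Proof.
by move=> Uw; rewrite -(cyclic_submoduleZ (vec2 _ 1) Uw) vec2Z mulr1 mulrC divrK.
Qed.

Lemma cyclic_vec2_0 (A : comUnitRingType) (x y u v w : A) :
  y = 0 -> x \is a GRing.unit ->
  cyclic_submodule (vec2 (x * u + y * w) (x * v + y)) = cyclic_submodule (vec2 u v).
Proof. by move=> -> Ux; rewrite mul0r !addr0 -vec2Z cyclic_submoduleZ. Qed.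

Lemma cyclic_vec2_1 (A : comUnitRingType) (x y u v w z : A) :
  y = 1 -> x * v + 1 \is a GRing.unit -> z * (x * v + 1) = x * u + w ->
  cyclic_submodule (vec2 z 1) = cyclic_submodule (vec2 (x * u + y * w) (x * v + y)).
Proof.
by move=> -> Uw zE; rewrite (cyclic_vec2_unit _ Uw) mul1r -zE mulrK.
Qed.

Lemma GL2_act_cyclic (A : 'M[LL R]_2) w :
  GL2_act A (cyclic_submodule w) = cyclic_submodule (w *m A).
Proof.
apply/seteqP; split=> [_ [_ [a _ <-] <-]|_ [a _ <-]].
  by exists a => //; rewrite scalemxAl.
by exists (a *: w); [exists a|rewrite scalemxAl].
Qed.

Lemma det2 (A : comNzRingType) (M : 'M[A]_2) : \det M = M 0 0 * M 1 1 - M 0 1 * M 1 0.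
Proof.
rewrite (expand_det_row _ 0) !big_ord_recl big_ord0 addr0 /cofactor !det_mx11 !mxE /=.
have -> : lift ord0 (ord0 : 'I_1) = 1 by apply/val_inj.
have -> : lift (1 : 'I_2) (0 : 'I_1) = 0 by apply/val_inj.
rewrite /bump /= !addn0 add0n expr0 expr1 mul1r mulN1r mulrN.
by congr (_ * _ - _).
Qed.

Definition normal_point v m c (s t : R) : set 'rV[LL R]_2 :=
  cyclic_submodule (vec2 (qpolyC 'X^3 s * v + qpolyC 'X^3 t * c)
                         (qpolyC 'X^3 s * m + qpolyC 'X^3 t)).

Definition normal_chain v m c : set (set 'rV[LL R]_2) :=
  [set p | exists s t, (s != 0 \/ t != 0) /\ p = normal_point v m c s t].

(** Multiplying by the inverse of the residue matrix reduces to a matrix that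
    is the identity modulo the maximal ideal.  Its last entry is then a unit,
    and dividing both coordinates by it does not change the point. *)
Lemma chain_normal_form (C : set (set 'rV[LL R]_2)) : is_chain C ->
  exists v m c, [/\ v`_0 = 1, m`_0 = 0, c`_0 = 0 & C = normal_chain v m c].
Proof.
move=> [M UM ->]; pose K := qpolyC ('X^3 : {poly R}).
set a := M 0 0; set b := M 0 1; set c := M 1 0; set d := M 1 1.
have D0 : a`_0 * d`_0 - b`_0 * c`_0 != 0.
  move: UM; rewrite unitmxE det2 -/a -/b -/c -/d => /LL_unitP.
  by rewrite !coefLLE.
set D := (X in X != 0) in D0.
(* The real coefficients are the entries of the inverse of the residue matrix. *)
pose a' := K (d`_0 / D) * a - K (b`_0 / D) * c.
pose b' := K (d`_0 / D) * b - K (b`_0 / D) * d.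
pose c' := K (a`_0 / D) * c - K (c`_0 / D) * a.
pose d' := K (a`_0 / D) * d - K (c`_0 / D) * b.
have d'0 : d'`_0 = 1 by rewrite !coefLLE /= /D; field.
have Ud' : d' \is a GRing.unit by apply/LL_unitP; rewrite d'0 oner_eq0.
have inv0 : (d'^-1)`_0 = 1.
  have := congr1 (fun z : LL R => z`_0) (mulrV Ud').
  by rewrite coefLLM0 d'0 mul1r coefLL1.
exists (a' / d'), (b' / d'), (c' / d'); split.
- by rewrite coefLLM0 inv0 !coefLLE /= /D; field.
- by rewrite coefLLM0 inv0 !coefLLE /= /D; field.
- by rewrite coefLLM0 inv0 !coefLLE /= /D; field.
have key s t : normal_point (a' / d') (b' / d') (c' / d') s t =
    cyclic_submodule (vec2 (K ((s * d`_0 - t * c`_0) / D)) (K ((t * a`_0 - s * b`_0) / D)) *m M).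
  rewrite vec2_mul -/a -/b -/c -/d /normal_point -(cyclic_submoduleZ _ Ud') vec2Z.
  congr (cyclic_submodule (vec2 _ _)).
    rewrite mulrDr ![d' * (_ * (_ / _))]mulrCA ![d' * (_ / _)]mulrCA mulrV // !mulr1 /a' /c'.
    rewrite /K !(mulrBl, qpolyCM) !rmorphB !rmorphM /=; ring.
  rewrite mulrDr [d' * (_ * (_ / _))]mulrCA [d' * (_ / _)]mulrCA mulrV // !mulr1 /b' /d'.
  rewrite /K !(mulrBl, qpolyCM) !rmorphB !rmorphM /=; ring.
apply/seteqP; split=> p.
  move=> [_ [x [y [xy ->]]] <-]; rewrite GL2_act_cyclic.
  exists (x * a`_0 + y * c`_0), (x * b`_0 + y * d`_0).
  have ex : ((x * a`_0 + y * c`_0) * d`_0 - (x * b`_0 + y * d`_0) * c`_0) / D = x.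
    by rewrite /D; field.
  have ey : ((x * b`_0 + y * d`_0) * a`_0 - (x * a`_0 + y * c`_0) * b`_0) / D = y.
    by rewrite /D; field.
  rewrite key ex ey; split=> //.
  have [s0|] := eqVneq (x * a`_0 + y * c`_0) 0; last by left.
  right; apply/eqP => t0; move: ex ey; rewrite s0 t0 !mul0r subrr mul0r => x0 y0.
  by case: xy; rewrite -?x0 -?y0 eqxx.
move=> [s [t [st ->]]]; rewrite key -GL2_act_cyclic.
set x := (X in K X); set y := (X in vec2 _ (K X)).
exists (cyclic_submodule (vec2 (K x) (K y))) => //; exists x, y; split=> //.
have [x0|] := eqVneq x 0; last by left.
right; apply/eqP => y0.
have es : s = x * a`_0 + y * c`_0 by rewrite /x /y /D; field.
have et : t = x * b`_0 + y * d`_0 by rewrite /x /y /D; field.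
move: es et; rewrite x0 y0 !mul0r addr0 => s0 t0.
by case: st; rewrite ?s0 ?t0 eqxx.
Qed.

Section NormalChain.
Variables (v m c : LL R).
Hypotheses (v0 : v`_0 = 1) (m0 : m`_0 = 0) (c0 : c`_0 = 0).

(** For [t != 0] the second coordinate [s m + t] is a unit, so the point is
    proper. *)
Lemma normal_chain_improper p : is_improper p -> normal_chain v m c p ->
  p = cyclic_submodule (vec2 v m).
Proof.
move=> [_ imp] [s [t [st pE]]]; have [t0|t0] := eqVneq t 0.
  have s0 : s != 0 by case: st => //; rewrite t0 eqxx.
  rewrite pE; apply: cyclic_vec2_0; first by rewrite t0 qpolyC0.
  by apply/LL_unitP; rewrite coefLLC.
case: imp; set w := qpolyC 'X^3 s * m + qpolyC 'X^3 t.
have Uw : w \is a GRing.unit by apply/LL_unitP; rewrite !coefLLE /= m0 mulr0 add0r.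
exists ((qpolyC 'X^3 s * v + qpolyC 'X^3 t * c) / w).
by rewrite pE /proper_point -cyclic_vec2_unit.
Qed.

Lemma normal_chain_has_improper : is_improper (cyclic_submodule (vec2 v m)) /\
  normal_chain v m c (cyclic_submodule (vec2 v m)).
Proof.
split; last first.
  exists 1, 0; split; first by left; exact: oner_neq0.
  by apply/esym/cyclic_vec2_0; [exact: qpolyC0 | apply/LL_unitP; rewrite coefLLC oner_eq0].
split; first by exists v, m; split=> //; left; apply/LL_unitP; rewrite v0 oner_eq0.
move=> [z e]; have := mem_cyclic_submodule (vec2 v m); rewrite e => -[a _].
rewrite vec2Z mulr1 => /(@vec2_inj (LL R)) [az am].
by have := congr1 (fun z : LL R => z`_0) az; rewrite coefLLM0 am m0 v0 mul0r => /esym/eqP;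
  rewrite oner_eq0.
Qed.

(** The quotient [(t v + c) / (t m + 1)] in coordinates; [m] has cube 0, so
    that [(1 + t m)^-1 = 1 - t m + t^2 m^2]. *)
Definition affine_curve (t : R) : LL R :=
  mkLL t (c`_1 + v`_1 * t - m`_1 * t ^+ 2)
    (c`_2 + (v`_2 - m`_1 * c`_1) * t - (v`_1 * m`_1 + m`_2) * t ^+ 2 + m`_1 ^+ 2 * t ^+ 3).

Lemma proper_part_affine_curve t : proper_part (normal_chain v m c) (affine_curve t).
Proof.
exists t, 1; split; first by right; exact: oner_neq0.
apply: cyclic_vec2_1; first exact: rmorph1.
  by apply/LL_unitP; rewrite !coefLLE /= m0 mulr0 add0r oner_eq0.
apply: LL_eqP; rewrite !coefLLE.
all: by rewrite !mkLLE //= ?v0 ?m0 ?c0; ring.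
Qed.

End NormalChain.

(** Both lines are of the form LL(1, m / v), and [m`_1] and
    [m`_2 - v`_1 * m`_1] are the coefficients of [m / v]. *)
Lemma improper_point_eq (v m v' m' : LL R) :
  v`_0 = 1 -> m`_0 = 0 -> v'`_0 = 1 -> m'`_0 = 0 ->
  cyclic_submodule (vec2 v m) = cyclic_submodule (vec2 v' m') <->
  m`_1 = m'`_1 /\ m`_2 - v`_1 * m`_1 = m'`_2 - v'`_1 * m'`_1.
Proof.
move=> v0 m0 v'0 m'0.
have Uv : v \is a GRing.unit by apply/LL_unitP; rewrite v0 oner_eq0.
have Uv' : v' \is a GRing.unit by apply/LL_unitP; rewrite v'0 oner_eq0.
split=> [e|[e1 e2]].
  have := mem_cyclic_submodule (vec2 v m); rewrite e => -[a _].
  rewrite vec2Z => /(@vec2_inj (LL R)) [av am].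
  have mv : m * v' = m' * v by rewrite -av -am; ring.
  have := congr1 (fun z : LL R => z`_1) mv.
  have := congr1 (fun z : LL R => z`_2) mv.
  rewrite /= !coefLLE v0 v'0 m0 m'0 => h2 h1.
  split; first by lra.
  by move: h1 h2; rewrite !mul0r !mulr1 !add0r => ->; lra.
have mv : m * v' = m' * v.
  apply: LL_eqP; rewrite !coefLLE v0 v'0 m0 m'0; first by ring.
    by rewrite e1; ring.
  by rewrite !mul0r !add0r !mulr1 -e1; move: e2; rewrite -e1; lra.
rewrite -(cyclic_submoduleZ _ Uv') -[RHS](cyclic_submoduleZ _ Uv) !vec2Z.
by rewrite [v' * v]mulrC [v' * m]mulrC mv [v * m']mulrC.
Qed.

End Chains.

(** * The twisted cubic carrying the proper part of a chain *)

Section NormalCubics.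
Variable R : realType.
Implicit Types (m k a b d g : R).

(** The rows belong to the monomials s^3, s^2 t, s t^2 and t^3.  The point f has
    parameters (0, 1), and X2 / X3 agrees with s / t to first order there.  The
    coefficients are arranged such that the 3-jet at f depends on [m] and [k]
    only. *)
Definition normal_mx m k a b d g : 'M[R]_4 :=
  \matrix_(i < 4) [:: row4 (- m) 0 a g; row4 0 1 b d; row4 0 0 1 (k + 2 * b); row4 0 0 0 1]`_i.

Lemma mul_normal_mx (x : 'rV[R]_4) m k a b d g :
  x *m normal_mx m k a b d g =
  row4 (- m * x``_0) x``_1 (a * x``_0 + b * x``_1 + x``_2)
    (g * x``_0 + d * x``_1 + (k + 2 * b) * x``_2 + x``_3).
Proof.
apply: row4P; rewrite !mul_row4 ![normal_mx _ _ _ _ _ _ _ _]mxE !inordK //= !row4E //=.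
by split; ring.
Qed.

Lemma normal_mx_unit m k a b d g : m != 0 -> normal_mx m k a b d g \in unitmx.
Proof.
move=> m0; rewrite -row_free_unit; apply: inj_row_free => x.
rewrite mul_normal_mx => x0.
have coord0 j : (j < 4)%N -> (0 : 'rV[R]_4)``_j = 0 by rewrite mxE.
move: (coord0 0%N isT) (coord0 1%N isT) (coord0 2 isT) (coord0 3 isT).
rewrite -x0 !row4E //= => /eqP; rewrite mulf_eq0 oppr_eq0 (negPf m0) /= => /eqP h0 h1.
rewrite h0 h1 !mulr0 !add0r => h2; rewrite h2 mulr0 add0r => h3.
by apply: row4P; rewrite !row4E //= h0 h1 h2 h3.
Qed.

Lemma embed_line_inj (z z' : LL R) : embed z = embed z' -> z`_0 = z'`_0.
Proof.
move=> e; have := mem_cyclic_submodule (row4 1 z`_0 z`_1 z`_2).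
rewrite [X in X _]e => -[u _] uE.
have := congr1 (fun x : 'rV[R]_4 => x``_0) uE.
have := congr1 (fun x : 'rV[R]_4 => x``_1) uE.
by rewrite /= !coordZ !row4E //= mulr1 => + u1; rewrite u1 mul1r.
Qed.

Section CubicExtension.
Variables (v m c : LL R) (K : set (set 'rV[R]_4)).
Hypotheses (K_cubic : twisted_cubic K) (K_curve : forall t, K (embed (affine_curve v m c t))).

Let p r := embed (affine_curve v m c r%:R).

Let p_inj : injective p.
Proof.
move=> r1 r2 /embed_line_inj; rewrite !mkLLE //= => /eqP.
by rewrite eqr_nat => /eqP.
Qed.

(** If [m`_1] vanished, the curve would lie in the plane
    [x2 = c`_1 + v`_1 * x1]. *)
Lemma affine_curve_nonplanar : m`_1 != 0.
Proof.
have [M UM KM] := K_cubic; apply/eqP => m10.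
pose n : 'cV[R]_4 := (row4 (- c`_1) (- v`_1) 1 0)^T.
suff /(congr1 (fun x : 'cV[R]_4 => x (inord 2) 0)) : n = 0.
  by rewrite /n mxE row4E //= mxE => /eqP; rewrite oner_eq0.
apply: (cubic_of_nonplanar UM p_inj) => [r|r x px].
  by have := K_curve r%:R; rewrite KM.
have := mem_cyclic_submodule x; rewrite -px => -[u _ <-].
apply/matrixP => i j; rewrite !ord1 mul_row4 /n !mxE !inordK //= !mkLLE //= m10.
by ring.
Qed.

(** The parameter [t] of the affine curve corresponds to the homogeneous
    parameters (1, - m`_1 t), which normalizes the coefficient of s t^2 in X2 to
    1; the common factor of the coordinates is then [- m`_1]. *)
Lemma cubic_extension_normal : K = cubic_of (normal_mx m`_1
  ((m`_2 - v`_1 * m`_1) / m`_1) (- m`_1 * c`_1) v`_1 (v`_2 - m`_1 * c`_1) (- m`_1 * c`_2)).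
Proof.
have m10 := affine_curve_nonplanar; have [M UM KM] := K_cubic.
set N := normal_mx _ _ _ _ _ _.
have UN : N \in unitmx by exact: normal_mx_unit.
have pM r : cubic_of M (p r) by have := K_curve r%:R; rewrite KM.
have pN r : cubic_of N (p r).
  exists 1, (- m`_1 * r%:R); split; first by left; exact: oner_neq0.
  have Um : - m`_1 \is a GRing.unit by rewrite unitfE oppr_eq0.
  rewrite /p /embed -(cyclic_submoduleZ _ Um); congr cyclic_submodule.
  rewrite mul_normal_mx std_cubicE !row4E //=.
  apply: row4P; rewrite !coordZ !row4E //= !mkLLE //=.
  by split; field.
rewrite -/(cubic_of M) in KM; rewrite KM; apply/seteqP.
by split; apply: cubic_of_sub p_inj _ _.
Qed.

End CubicExtension.

End NormalCubics.

(** * Iterated derivatives on an interval *)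

Section Calculus.
Variable R : realType.

Section Smooth.
Variable V : normedModType R.
Implicit Types (f g : R -> V) (d t : R).

Definition smooth_on d f := forall n t, `|t| < d -> derivable (derive1n n f) t 1.

Lemma near_ball d t : `|t| < d -> \forall x \near t, `|x| < d.
Proof.
move=> td; apply: (open_nbhs_nbhs (A := [set x | `|x| < d])); split => //.
apply: (@open_comp _ _ (fun x : R => `|x|) [set y | y < d]) => [x _|].
  exact: norm_continuous.
exact: open_lt.
Qed.

(** The induction step of all computations of iterated derivatives below: a
    closed formula for the n-th derivative on an interval can be
    differentiated there, because the derivative is a local notion. *)
Lemma derive1n_step d f n g g' : (forall t, `|t| < d -> derive1n n f t = g t) ->
  (forall t, `|t| < d -> is_derive t 1 g (g' t)) ->
  forall t, `|t| < d ->
    derivable (derive1n n f) t 1 /\ derive1n n.+1 f t = g' t.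
Proof.
move=> fg gg' t td; have [dg <-] := gg' t td.
have eqgf : {near t, g =1 derive1n n f}.
  by apply: filterS (near_ball td) => x /fg.
split; first exact: near_eq_derivable dg.
by rewrite derive1nS derive1E (near_eq_derive _ eqgf).
Qed.

Lemma smooth_is_derive d f n t : smooth_on d f -> `|t| < d ->
  is_derive t 1 (derive1n n f) (derive1n n.+1 f t).
Proof. by move=> fs td; rewrite derive1nS derive1E; exact/derivableP/fs. Qed.

Lemma derive1n_eq_on d f g n : (forall t, `|t| < d -> f t = g t) ->
  forall t, `|t| < d -> derive1n n f t = derive1n n g t.
Proof.
move=> fg; elim: n => // n IHn t td; rewrite !derive1nS !derive1E.
apply: near_eq_derive; apply: filterS (near_ball td) => x.
exact: IHn.
Qed.

Lemma smooth_on_eq d f g : (forall t, `|t| < d -> f t = g t) ->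
  smooth_on d f -> smooth_on d g.
Proof.
move=> fg fs n t td; apply: near_eq_derivable (fs n t td).
by apply: filterS (near_ball td) => x; exact: derive1n_eq_on.
Qed.

Lemma smooth_onD d f g : smooth_on d f -> smooth_on d g ->
  smooth_on d (fun x => f x + g x) /\
  forall n t, `|t| < d ->
    derive1n n (fun x => f x + g x) t = derive1n n f t + derive1n n g t.
Proof.
move=> fs gs.
have der n (t : R) : `|t| < d -> is_derive t 1 (fun x => derive1n n f x + derive1n n g x)
    (derive1n n.+1 f t + derive1n n.+1 g t).
  by move=> td; apply: is_deriveD; exact: smooth_is_derive td.
have eqD n : forall t, `|t| < d ->
    derive1n n (fun x => f x + g x) t = derive1n n f t + derive1n n g t.
  elim: n => [t td //|n IHn t td].
  by rewrite (derive1n_step IHn (der n) td).2.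
by split=> // n t td; exact: (derive1n_step (eqD n) (der n) td).1.
Qed.

End Smooth.

Lemma is_derive1M (f g : R -> R) (t df dg : R) : is_derive t 1 f df -> is_derive t 1 g dg ->
  is_derive t 1 (fun x => f x * g x) (df * g t + f t * dg).
Proof.
move=> f' g'; have fg := @is_deriveM _ _ f g t 1 df dg f' g'.
by apply: (is_derive_eq fg); rewrite addrC [X in X + _]mulrC.
Qed.

Lemma derive1n_mul d (u v : R -> R) : smooth_on d u -> smooth_on d v ->
  forall t, `|t| < d ->
  let w x := u x * v x in
  [/\ derive1n 1 w t = derive1n 1 u t * v t + u t * derive1n 1 v t,
      derive1n 2 w t = derive1n 2 u t * v t + 2 * (derive1n 1 u t * derive1n 1 v t)
                     + u t * derive1n 2 v t
    & derive1n 3 w t = derive1n 3 u t * v t + 3 * (derive1n 2 u t * derive1n 1 v t)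
        + 3 * (derive1n 1 u t * derive1n 2 v t) + u t * derive1n 3 v t].
Proof.
move=> us vs t td w.
pose U n := derive1n n u; pose V n := derive1n n v.
have der i j (x : R) : `|x| < d ->
    is_derive x 1 (fun x => U i x * V j x) (U i.+1 x * V j x + U i x * V j.+1 x).
  by move=> xd; apply: is_derive1M; exact: smooth_is_derive xd.
have s1 (x : R) xd := (derive1n_step (n := 0) (f := w) (g := fun x => U 0 x * V 0 x)
  (fun x _ => erefl) (der 0 0)%N (t := x) xd).2.
have s2 (x : R) xd := (derive1n_step s1 (fun x xd =>
  is_deriveD (der 1 0 x xd) (der 0 1 x xd))%N (t := x) xd).2.
have s3 := (derive1n_step s2 (fun x xd => is_deriveD
  (is_deriveD (der 2 0 x xd) (der 1 1 x xd)) (is_deriveD (der 1 1 x xd) (der 0 2 x xd)))%N td).2.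
rewrite -[u t]/(U 0%N t) -[v t]/(V 0%N t) (s1 t td) (s2 t td) s3.
rewrite -![derive1n _ u t]/(U _ t) -![derive1n _ v t]/(V _ t) {s1 s2 s3 der}.
move: (U 0%N t) (U 1%N t) (U 2 t) (U 3 t) (V 0%N t) (V 1%N t) (V 2 t) (V 3 t).
by move=> U0 U1 U2 U3 V0 V1 V2 V3; split; ring.
Qed.

(** This is how the quadratic equations of a curve are differentiated. *)
Lemma derive1n_mul_eq d (u v u' v' : R -> R) :
  smooth_on d u -> smooth_on d v -> smooth_on d u' -> smooth_on d v' ->
  (forall t, `|t| < d -> u t * v t = u' t * v' t) -> forall t, `|t| < d ->
  [/\ derive1n 1 u t * v t + u t * derive1n 1 v t =
       derive1n 1 u' t * v' t + u' t * derive1n 1 v' t,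
      derive1n 2 u t * v t + 2 * (derive1n 1 u t * derive1n 1 v t) + u t * derive1n 2 v t =
      derive1n 2 u' t * v' t + 2 * (derive1n 1 u' t * derive1n 1 v' t) + u' t * derive1n 2 v' t
    & derive1n 3 u t * v t + 3 * (derive1n 2 u t * derive1n 1 v t)
        + 3 * (derive1n 1 u t * derive1n 2 v t) + u t * derive1n 3 v t =
      derive1n 3 u' t * v' t + 3 * (derive1n 2 u' t * derive1n 1 v' t)
        + 3 * (derive1n 1 u' t * derive1n 2 v' t) + u' t * derive1n 3 v' t].
Proof.
move=> us vs us' vs' e t td.
have [l1 l2 l3] := derive1n_mul us vs td; have [r1 r2 r3] := derive1n_mul us' vs' td.
have eD n := derive1n_eq_on n e td.
by split; [exact: etrans (esym l1) (etrans (eD 1%N) r1)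
         | exact: etrans (esym l2) (etrans (eD 2%N) r2)
         | exact: etrans (esym l3) (etrans (eD 3%N) r3)].
Qed.

Lemma is_derive_coord (f : R -> 'rV[R]_4) (t : R) df i : is_derive t 1 f df ->
  is_derive t 1 (fun x => f x 0 i) (df 0 i).
Proof.
move=> [fd <-]; rewrite derive_mx // mxE; apply: derivableP.
exact: (derivable_mxP _ _ _).1.
Qed.

Lemma derive1n_mulmx d (f : R -> 'rV[R]_4) p (N : 'M[R]_(4, p)) (j : 'I_p) : smooth_on d f ->
  smooth_on d (fun x => (f x *m N) 0 j) /\
  forall n t, `|t| < d ->
    derive1n n (fun x => (f x *m N) 0 j) t = (derive1n n f t *m N) 0 j.
Proof.
move=> fs.
have der n (t : R) : `|t| < d -> is_derive t 1 (fun x => (derive1n n f x *m N) 0 j)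
    ((derive1n n.+1 f t *m N) 0 j).
  move=> td; rewrite mul_row4.
  rewrite [X in is_derive _ _ X _](_ : _ = (fun x => (derive1n n f x)``_0 * N (inord 0) j
    + (derive1n n f x)``_1 * N (inord 1) j + (derive1n n f x)``_2 * N (inord 2) j
    + (derive1n n f x)``_3 * N (inord 3) j)); last by apply/funext => x; rewrite mul_row4.
  have term (i : 'I_4) : is_derive t 1 (fun x => (derive1n n f x) 0 i * N i j) (derive1n n.+1 f t 0 i * N i j).
    have df := is_derive_coord i (smooth_is_derive n fs td).
    have dN : is_derive t 1 (fun=> N i j) (0 : R) by exact: is_derive_cst.
    by apply: (is_derive_eq (is_derive1M df dN)); rewrite mulr0 addr0.
  by do 3!apply: is_deriveD.
have eqD n : forall t, `|t| < d ->
    derive1n n (fun x => (f x *m N) 0 j) t = (derive1n n f t *m N) 0 j.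
  elim: n => [t td //|n IHn t td].
  by rewrite (derive1n_step IHn (der n) td).2.
by split=> // n t td; exact: (derive1n_step (eqD n) (der n) td).1.
Qed.

Lemma derive1n_row d (f : 'I_4 -> R -> R) : (forall i, smooth_on d (f i)) ->
  smooth_on d (fun x => \row_i f i x : 'rV[R]_4) /\
  forall n t, `|t| < d ->
    derive1n n (fun x => \row_i f i x : 'rV[R]_4) t = \row_i derive1n n (f i) t.
Proof.
move=> fs.
have der n (t : R) : `|t| < d -> is_derive t 1 (fun x => \row_i derive1n n (f i) x : 'rV[R]_4)
    (\row_i derive1n n.+1 (f i) t).
  move=> td.
  have dr : derivable (fun x => \row_i derive1n n (f i) x : 'rV[R]_4) t 1.
    apply/derivable_mxP => i j.
    rewrite [X in derivable X](_ : _ = derive1n n (f j)); first exact: fs.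
    by apply/funext => x; rewrite mxE.
  apply: DeriveDef => //; rewrite derive_mx //; apply/rowP => j; rewrite !mxE.
  rewrite derive1nS derive1E; congr ('D_1 _ t).
  by apply/funext => x; rewrite mxE.
have eqD n : forall t, `|t| < d ->
    derive1n n (fun x => \row_i f i x : 'rV[R]_4) t = \row_i derive1n n (f i) t.
  elim: n => [t td //|n IHn t td].
  by rewrite (derive1n_step IHn (der n) td).2.
by split=> // n t td; exact: (derive1n_step (eqD n) (der n) td).1.
Qed.

Section RationalFunctions.
Variables (d : R) (q : {poly R}).
Hypothesis q_neq0 : forall t, `|t| < d -> q.[t] != 0.

Lemma is_derive_ratfun (p : {poly R}) k (t : R) : q.[t] != 0 ->
  is_derive t 1 (fun x => p.[x] / q.[x] ^+ k)
    ((p^`() * q - p * q^`() *+ k).[t] / q.[t] ^+ k.+1).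
Proof.
move=> qt0; have qk0 : (q ^+ k).[t] != 0 by rewrite horner_exp expf_neq0.
rewrite [X in is_derive _ _ X _](_ : _ = fun x => p.[x] * ((q ^+ k).[x])^-1); last first.
  by apply/funext => x; rewrite horner_exp.
have dV : is_derive t 1 (fun x => ((q ^+ k).[x])^-1) ('D_1 (fun x => ((q ^+ k).[x])^-1) t).
  by apply: derivableP; apply: derivableV => //; exact: derivable_horner.
apply: (is_derive_eq (is_derive1M (is_derive_poly p t) dV)).
rewrite deriveV //.
rewrite -derive1E -derivE deriv_exp !(hornerE, hornerMn, horner_exp).
rewrite /GRing.scale /= -[_ * _ ^+ _ *+ k]mulr_natr -[_ * _^`().[t] *+ k]mulr_natr {dV qk0}.
case: k => [|k] /=; first by rewrite !expr0; field.
have := expf_neq0 k qt0; rewrite !exprS; move: (q.[t] ^+ k) => Q Q0.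
by field; rewrite Q0 qt0.
Qed.

(** The derivative of a fraction with numerator divisible by X^e loses at most
    one factor X, and its denominator is again a power of [q]. *)
Lemma ratfun_step e k (p : {poly R}) : exists k' (p' : {poly R}), forall t : R, `|t| < d ->
  is_derive t 1 (fun x => ('X^e * p).[x] / q.[x] ^+ k) (('X^(e.-1) * p').[t] / q.[t] ^+ k').
Proof.
pose p' := if e is _.+1 then (p *+ e + 'X * p^`()) * q - 'X * p * q^`() *+ k
           else p^`() * q - p * q^`() *+ k.
exists k.+1, p' => t td; have qt0 := q_neq0 td.
apply: is_derive_eq; first exact: is_derive_ratfun.
congr (_.[t] / _); rewrite /p'; case: (e) => [|e'].
  by rewrite expr0 !mul1r.
rewrite derivM derivXn /= exprS.
rewrite -[p *+ _]mulr_natr -['X^e' *+ _]mulr_natr.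
rewrite -['X * 'X^e' * _ * _ *+ k]mulr_natr -['X * p * _ *+ k]mulr_natr; ring.
Qed.

Lemma smooth_ratfun_vanishing e k (p : {poly R}) :
  let f x := ('X^e * p).[x] / q.[x] ^+ k in
  smooth_on d f /\ forall n, (n < e)%N -> 0 < d -> derive1n n f 0 = 0.
Proof.
move=> f.
have eqD n : exists k' (p' : {poly R}), forall t, `|t| < d ->
    derive1n n f t = ('X^(e - n) * p').[t] / q.[t] ^+ k'.
  elim: n => [|n [k' [p' IHn]]]; first by exists k, p; rewrite subn0.
  have [k2 [p2 st]] := ratfun_step (e - n) k' p'; exists k2, p2 => t td.
  by rewrite (derive1n_step IHn st td).2 subnS.
split=> n.
  move=> t td; have [k' [p' IHn]] := eqD n.
  have [k2 [p2 st]] := ratfun_step (e - n) k' p'.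
  exact: (derive1n_step IHn st td).1.
move=> ne d0; have [k' [p' ->]] := eqD n; last by rewrite normr0.
by rewrite hornerM hornerXn expr0n subn_eq0 leqNgt ne /= !mul0r.
Qed.

Lemma smooth_ratfun p : smooth_on d (fun x => p.[x] / q.[x]).
Proof.
have [s _] := smooth_ratfun_vanishing 0 1 p.
by refine (smooth_on_eq _ s) => x _; rewrite expr0 mul1r expr1.
Qed.

(** The difference of [p / q] and [c] is X^e r / q, whose derivatives of order
    below e vanish at 0; no derivative of a quotient has to be computed. *)
Lemma derive1n_ratfun_congr e (p c r : {poly R}) n : p = q * c + 'X^e * r ->
  0 < d -> (n < e)%N ->
  derive1n n (fun x => p.[x] / q.[x]) 0 = derive1n n (horner c) 0.
Proof.
move=> pE d0 ne; have d00 : `|0 : R| < d by rewrite normr0.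
have [s v] := smooth_ratfun_vanishing e 1 r.
have cs : smooth_on d (horner c).
  have [s0 _] := smooth_ratfun_vanishing 0 0 c.
  by refine (smooth_on_eq _ s0) => x _; rewrite !expr0 mul1r divr1.
have [s1 sD] := smooth_onD cs s.
have eqf t : `|t| < d -> c.[t] + ('X^e * r).[t] / q.[t] ^+ 1 = p.[t] / q.[t].
  by move=> td; rewrite pE !hornerD !hornerM expr1; field; exact: q_neq0.
by rewrite -(derive1n_eq_on _ eqf) // sD // v // addr0.
Qed.

End RationalFunctions.

End Calculus.

(** * Reading the invariants off a 3-jet *)

Section JetInvariants.
Variable R : realType.

Lemma point_f_representative (x : 'rV[R]_4) : cyclic_submodule x = point_f R ->
  exists2 z, z != 0 & x = row4 0 0 0 z.
Proof.
move=> xf; have d0 : (delta_mx 0 ord_max : 'rV[R]_4) = row4 0 0 0 1.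
  by apply: row4P; rewrite !row4E //= !mxE -!val_eqE /= !inordK.
have d1 : (delta_mx 0 ord_max : 'rV[R]_4) != 0.
  apply/eqP => /rowP /(_ (inord 3)); rewrite d0 row4E // mxE => /eqP.
  by rewrite oner_eq0.
have [z z0 dz] := cyclic_submodule_scaled d1 (esym xf).
exists z^-1; first by rewrite invr_eq0.
have -> : x = z^-1 *: row4 0 0 0 1 by rewrite -d0 dz scalerA mulVf // scale1r.
by apply: row4P; rewrite !coordZ !row4E //= !mulr0 mulr1.
Qed.

(** In the coordinates [y] adapted to the cubic, the equations y1 y3 = y2^2 and
    y0 y3 = y1 y2 are differentiated up to order three at f, where only
    y3 is nonzero.  With r := y2'(0) they show that y1 and y0 vanish to the
    orders two and three, y1'' being proportional to r^2 and y0''' to r^3; the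
    remaining relation comes from the third derivative of the first equation.
    Regularity of the parametrization gives r <> 0. *)
Lemma jet_invariants (m k a b c e : R) K w (g : R -> 'rV[R]_4) : m != 0 ->
  K = cubic_of (normal_mx m k a b c e) -> local_parametrization K w g ->
  cyclic_submodule (g 0) = point_f R ->
  let J n := derive1n n g 0 in
  [/\ (J 2%N)``_1 * (J 1%N)``_2 != 0,
      (J 3%N)``_0 * (J 0%N)``_3 = - m * (3 * ((J 2%N)``_1 * (J 1%N)``_2))
    & (J 3%N)``_1 * (J 0%N)``_3 + 3 * ((J 2%N)``_1 * (J 1%N)``_3) - 6 * ((J 1%N)``_2 * (J 2%N)``_2)
        = k * (3 * ((J 2%N)``_1 * (J 1%N)``_2))].
Proof.
move=> m0 KE [d [U [d0 gs g'0 _ [_ gK]]]] g0 J.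
set N := normal_mx _ _ _ _ _ _ in KE; have UN : N \in unitmx by exact: normal_mx_unit.
have d00 : `|0 : R| < d by rewrite normr0.
pose y j t := (g t *m invmx N) 0 (inord j); pose Y n := J n *m invmx N.
have JY n : J n = Y n *m N by rewrite mulmxKV.
have ys j : smooth_on d (y j) by exact: (derive1n_mulmx _ _ gs).1.
have yY j n : derive1n n (y j) 0 = (Y n)``_j by exact: (derive1n_mulmx _ _ gs).2.
have gw t : `|t| < d -> g t *m w = 1%:M /\ K (cyclic_submodule (g t)).
  move=> td; suff : (U `&` [set x | x *m w = 1%:M /\ K (cyclic_submodule x)]) (g t) by case.
  by rewrite -gK; exists t.
have quad t : `|t| < d -> on_quadrics (g t *m invmx N).
  move=> /gw [gtw]; rewrite KE -{1}[g t](mulmxKV UN) => /cubic_ofP; apply=> //.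
  rewrite mulmx_unit_eq0 ?unitmx_inv //; apply/eqP => gt0.
  by move/matrixP/(_ 0 0): gtw; rewrite gt0 mul0mx !mxE => /eqP; rewrite eq_sym oner_eq0.
have qy1 t : `|t| < d -> y 1%N t * y 3%N t = y 2%N t * y 2%N t by move=> /quad[].
have qy2 t : `|t| < d -> y 0%N t * y 3%N t = y 1%N t * y 2%N t by move=> /quad[].
have [z z0 J0] : exists2 z, z != 0 & J 0%N = row4 0 0 0 z by exact: point_f_representative.
have J0w : J 0%N *m w = 1%:M by exact: (gw 0 d00).1.
have J1_neq0 : J 1%N != 0 by exact: g'0.
have J1w : J 1%N *m w = 0.
  have gw1 t : `|t| < d -> (g t *m w) 0 0 = (cst 1 : R -> R) t.
    by move=> /gw [-> _]; rewrite mxE eqxx.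
  apply/matrixP => i j; rewrite !ord1 [RHS]mxE.
  rewrite -((derive1n_mulmx w 0 gs).2 1%N 0 d00) (derive1n_eq_on 1 gw1 d00).
  by rewrite derive1n1 derive1_cst.
(* Only the values of the derivatives at 0 matter from now on. *)
clearbody y Y J.
have [Y00 Y01 Y02 Y03] : [/\ (Y 0%N)``_0 = 0, (Y 0%N)``_1 = 0, (Y 0%N)``_2 = 0 & (Y 0%N)``_3 = z].
  suff -> : Y 0%N = row4 0 0 0 z by rewrite !row4E.
  apply: (can_inj (mulmxK UN)); rewrite -JY J0.
  by rewrite mul_normal_mx !row4E //= !mulr0 !add0r.
have y0Y j : y j 0 = (Y 0%N)``_j by rewrite -(yY j 0%N).
have [q11 q12 q13] := derive1n_mul_eq (ys _) (ys _) (ys _) (ys _) qy1 d00.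
have [q21 q22 q23] := derive1n_mul_eq (ys _) (ys _) (ys _) (ys _) qy2 d00.
move: q11 q12 q13 q21 q22 q23; rewrite !yY !y0Y Y00 Y01 Y02 Y03.
move=> q11 q12 q13 q21 q22 q23.
clear g y g0 gs g'0 gK gw quad ys yY y0Y qy1 qy2.
have Y10 : (Y 1%N)``_0 = 0.
  move: q21.
  rewrite !(mul0r, mulr0, addr0) => /eqP; rewrite mulf_eq0 (negPf z0) orbF.
  by move/eqP.
have Y11 : (Y 1%N)``_1 = 0.
  move: q11.
  rewrite !(mul0r, mulr0, addr0) => /eqP; rewrite mulf_eq0 (negPf z0) orbF.
  by move/eqP.
(* If y2'(0) = 0, then g'(0) is a multiple of g(0); as [g *m w] is constant and
   nonzero, g'(0) would be 0. *)
have Y12 : (Y 1%N)``_2 != 0.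
  apply: contraNneq J1_neq0 => Y12.
  have J1 : J 1%N = row4 0 0 0 (Y 1%N)``_3.
    rewrite JY mul_normal_mx Y10 Y11 Y12.
    by rewrite !mulr0 !add0r.
  have J1E : J 1%N = ((Y 1%N)``_3 / z) *: J 0%N.
    rewrite J1 J0; apply: row4P; rewrite !coordZ !row4E //= !mulr0.
    by rewrite divfK.
  move: J1w; rewrite J1E -scalemxAl J0w => /matrixP/(_ 0 0).
  by rewrite [LHS]mxE !mxE mulr1 => ->; rewrite scale0r.
set r := (Y 1%N)``_2 in Y12.
have Y20 : (Y 2%N)``_0 = 0.
  move: q22; rewrite Y10 Y11.
  rewrite !(mul0r, mulr0, addr0) => /eqP; rewrite mulf_eq0 (negPf z0) orbF.
  by move/eqP.
have Y21 : (Y 2%N)``_1 * z = 2 * r ^+ 2.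
  move: q12; rewrite Y11.
  by rewrite !(mul0r, mulr0, addr0, add0r) expr2.
have Y21_neq0 : (Y 2%N)``_1 != 0.
  apply: contraNneq Y12 => Y21_0; move: Y21; rewrite Y21_0 mul0r => /esym/eqP.
  by rewrite mulf_eq0 pnatr_eq0 /= sqrf_eq0.
have Y30 : (Y 3%N)``_0 * z = 3 * ((Y 2%N)``_1 * r).
  move: q23; rewrite Y10 Y11 Y20.
  by rewrite !(mul0r, mulr0, addr0, add0r).
have Y31 : (Y 3%N)``_1 * z + 3 * ((Y 2%N)``_1 * (Y 1%N)``_3) = 6 * ((Y 2%N)``_2 * r).
  move: q13; rewrite Y11.
  rewrite !(mul0r, mulr0, addr0, add0r) => ->; rewrite -/r; ring.
have J03 : (J 0%N)``_3 = z by rewrite J0 row4E.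
have J30 : (J 3%N)``_0 = - m * (Y 3%N)``_0 by rewrite JY mul_normal_mx row4E.
have J21 : (J 2%N)``_1 = (Y 2%N)``_1 by rewrite JY mul_normal_mx row4E.
have J31 : (J 3%N)``_1 = (Y 3%N)``_1 by rewrite JY mul_normal_mx row4E.
have J12 : (J 1%N)``_2 = r by rewrite JY mul_normal_mx row4E //= Y10 Y11 !mulr0 !add0r.
have J22 : (J 2%N)``_2 = b * (Y 2%N)``_1 + (Y 2%N)``_2.
  by rewrite JY mul_normal_mx row4E //= Y20 mulr0 add0r.
have J13 : (J 1%N)``_3 = (k + 2 * b) * r + (Y 1%N)``_3.
  by rewrite JY mul_normal_mx row4E //= Y10 Y11 !mulr0 !add0r.
rewrite J03 J30 J21 J31 J12 J22 J13; split.
- by rewrite mulf_neq0.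
- by rewrite -mulrA Y30.
- have -> : (Y 3%N)``_1 * z = 6 * ((Y 2%N)``_2 * r) - 3 * ((Y 2%N)``_1 * (Y 1%N)``_3).
    by rewrite -Y31 addrK.
  ring.
Qed.

End JetInvariants.

(** * A parametrization with prescribed 3-jet *)

Section CanonicalJet.

Section Congruence.
Variables (A : comNzRingType) (X m k a b d g : A).

(** A cubic polynomial substituted for the parameter s / t.  Its quadratic and
    cubic coefficients are the unique ones for which X2 / X3 = X + O(X^4). *)
Definition reparam := X * (1 + X * ((b + k) + (k * (b + k) - a + d) * X)).
(** The coordinate X3 of the cubic [normal_mx m k a b d g] at [s := reparam]
    and t := 1. *)
Definition denom := 1 + (k + 2 * b) * reparam + d * reparam ^+ 2 + g * reparam ^+ 3.

(** The other three coordinates, divided by [denom], are - m X^3, X^2 + k X^3 and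
    X modulo X^4.  Here [reparam = X * u] with [u = 1 + X * v] and
    [denom = 1 + (k + 2 * b) * X * u + X^2 * w]; the remainders are found by
    factoring out powers of X one after the other. *)
Lemma canonical_congruence :
  [/\ exists r, - m * reparam ^+ 3 = denom * (- m * X ^+ 3) + X ^+ 4 * r,
      exists r, reparam ^+ 2 = denom * (X ^+ 2 + k * X ^+ 3) + X ^+ 4 * r
    & exists r, a * reparam ^+ 3 + b * reparam ^+ 2 + reparam = denom * X + X ^+ 4 * r].
Proof.
pose B := b + k; pose C := k * B - a + d; pose v := B + C * X; pose u := 1 + X * v; pose w := d * u ^+ 2 + g * X * u ^+ 3.
split.
- exists (m * ((k + 2 * b) * u + X * w - 3 * v - 3 * X * v ^+ 2 - X ^+ 2 * v ^+ 3)).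
  by rewrite /w /u /v /denom /reparam /C /B; ring.
- exists (2 * C + v ^+ 2 - (k + 2 * b) * v - w - k * ((k + 2 * b) * u + X * w)).
  by rewrite /w /u /v /denom /reparam /C /B; ring.
- exists (2 * b * C + b * v ^+ 2 + a * (3 * v + 3 * X * v ^+ 2 + X ^+ 2 * v ^+ 3)
    - (k + 2 * b) * C - (d * (2 * v + X * v ^+ 2) + g * u ^+ 3)).
  by rewrite /w /u /v /denom /reparam /C /B; ring.
Qed.

End Congruence.

Variable R : realType.

Lemma poly_pos_near0 (p : {poly R}) : 0 < p.[0] ->
  exists2 r : R, 0 < r & forall t, `|t| < r -> 0 < p.[t].
Proof.
move=> p0; have := @continuous_horner R p 0.
move=> /(_ [set y | 0 < y]) /=.
have : nbhs p.[0] [set y : R | 0 < y] by apply: open_nbhs_nbhs; split => //; exact: open_gt.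
move=> /[swap] /[apply] /nbhs_ballP [r r0 rp].
by exists r => // t tr; apply: rp; rewrite /ball /= sub0r normrN.
Qed.

Lemma poly_incr (p : {poly R}) r : (forall t, `|t| < r -> 0 < p^`().[t]) ->
  forall x y, `|x| < r -> `|y| < r -> x < y -> p.[x] < p.[y].
Proof.
move=> p' x y xr yr xy.
have zr z : z \in `]x, y[ -> `|z| < r.
  rewrite in_itv /= => /andP[xz zy]; move: xr yr; rewrite !ltr_norml.
  by move=> /andP[rx _] /andP[_ yr]; rewrite (lt_trans rx xz) (lt_trans zy yr).
apply: (@gtr0_derive1_lt_cc _ (horner p) x y) => //.
- by move=> z zxy; rewrite -derivE; exact/p'/zr.
- by apply: continuous_subspaceT => z; exact: continuous_horner.
- by rewrite in_itv /= lexx ltW.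
- by rewrite in_itv /= lexx ltW.
Qed.

(** The 3-jet at f common to all cubics with the invariants [m] and [k]. *)
Definition canonical_jet (m k : R) : 'I_4 -> {poly R} := fun i =>
  [:: - m%:P * 'X ^+ 3; 'X ^+ 2 + k%:P * 'X ^+ 3; 'X; 1]`_i.

Lemma open_linear_pos (l : 'cV[R]_4) : open [set x : 'rV[R]_4 | 0 < (x *m l) 0 0].
Proof.
apply: (@open_comp _ _ (fun x : 'rV[R]_4 => (x *m l) 0 0) [set y | 0 < y]); last exact: open_gt.
move=> x _; rewrite (_ : (fun x => _) = fun x : 'rV[R]_4 => x``_0 * l (inord 0) 0 +
    x``_1 * l (inord 1) 0 + x``_2 * l (inord 2) 0 + x``_3 * l (inord 3) 0); last first.
  by apply/funext => z; rewrite mul_row4.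
have term i : {for x, continuous (fun x : 'rV[R]_4 => x 0 i * l i 0)}.
  by apply: continuousM; [exact: coord_continuous|exact: cst_continuous].
exact: (continuousD (continuousD (continuousD (term _) (term _)) (term _)) (term _)).
Qed.

Lemma mul_delta3 (x : 'rV[R]_4) : x *m delta_mx (inord 3) 0 = (x``_3)%:M.
Proof.
apply/matrixP => i j; rewrite !ord1 mul_row4 !mxE eqxx andbT.
by rewrite -!val_eqE /= !inordK //= !mulr0 mulr1 !add0r mulr1n.
Qed.

(** The curve is parametrized by [phi := reparam] and divided by its last
    coordinate.  The radius is chosen such that the denominator, the
    derivative of the coordinate X2 and the derivative of [phi] stay positive.
    In adapted coordinates y2 / y3 = phi, so that by monotonicity and the
    intermediate value theorem the image is the part of the curve where
    y2 / y3 lies between the values of [phi] at the ends of the interval. *)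
Lemma canonical_parametrization (m k a b d g : R) : m != 0 ->
  exists G : R -> 'rV[R]_4,
    [/\ local_parametrization (cubic_of (normal_mx m k a b d g)) (delta_mx (inord 3) 0) G,
        cyclic_submodule (G 0) = point_f R
      & forall n, (n <= 3)%N ->
          derive1n n G 0 = \row_i derive1n n (horner (canonical_jet m k i)) 0].
Proof.
move=> m0; set N := normal_mx _ _ _ _ _ _; have UN : N \in unitmx by exact: normal_mx_unit.
pose phi := reparam 'X k%:P a%:P b%:P d%:P.
pose q := denom 'X k%:P a%:P b%:P d%:P g%:P.
have phi0 : phi.[0] = 0 by rewrite /phi /reparam !hornerE.
have q0 : q.[0] = 1.
  by rewrite /q /denom -/phi {q}; clearbody phi; rewrite !hornerE phi0 /= !(mulr0, mul0r, addr0).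
have phi'0 : phi^`().[0] = 1 by rewrite /phi /reparam !(poly.derivE, hornerE).
pose P (i : 'I_4) := [:: - m%:P * phi ^+ 3; phi ^+ 2; a%:P * phi ^+ 3 + b%:P * phi ^+ 2 + phi; q]`_i.
(* The numerator of the derivative of the coordinate X2. *)
pose D := (P (inord 2))^`() * q - P (inord 2) * q^`().
have D0 : 0 < D.[0].
  rewrite /D /P !inordK //=; clear P D; clearbody q phi.
  by rewrite !(poly.derivE, hornerE) phi0 phi'0 q0 /= !(mulr0, mul0r, mulr1, mul1r, mul0rn, add0r, addr0, oppr0, subr0).
have Pcongr i : exists r, P i = q * canonical_jet m k i + 'X^4 * r.
  have [c0 c1 c2] := canonical_congruence 'X m%:P k%:P a%:P b%:P d%:P g%:P.
  case: i => -[|[|[|[|]]]] // i; rewrite /P /canonical_jet /=.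
  by exists 0; rewrite mulr1 mulr0 addr0.
have qE : q = 1 + (k%:P + 2 * b%:P) * phi + d%:P * phi ^+ 2 + g%:P * phi ^+ 3 by [].
clearbody q phi.
have [r r0 rP] : exists2 r : R, 0 < r &
    forall t : R, `|t| < r -> [/\ 0 < q.[t], 0 < D.[t] & 0 < phi^`().[t]].
  have [r1 r10 r1P] := @poly_pos_near0 q (eq_ind_r (fun z => 0 < z) ltr01 q0).
  have [r2 r20 r2P] := poly_pos_near0 D0.
  have [r3 r30 r3P] := @poly_pos_near0 phi^`() (eq_ind_r (fun z => 0 < z) ltr01 phi'0).
  exists (Num.min r1 (Num.min r2 r3)); first by rewrite !lt_min r10 r20 r30.
  by move=> t; rewrite !lt_min => /and3P[t1 t2 t3]; split; [exact: r1P|exact: r2P|exact: r3P].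
have phi_incr (x y : R) : `|x| < r -> `|y| < r -> x < y -> phi.[x] < phi.[y].
  by apply: poly_incr => t /rP[].
(* Half the radius, because [phi] has to be increasing on the closed interval. *)
pose e := r / 2; have e0 : 0 < e by rewrite divr_gt0.
have er : e < r by rewrite /e; lra.
have te (t : R) : `|t| < e -> `|t| < r by move=> /lt_trans; apply.
have qpos (t : R) : `|t| < e -> 0 < q.[t] by move=> /te /rP[].
have qn0 (t : R) : `|t| < e -> q.[t] != 0 by move=> /qpos; rewrite lt0r => /andP[].
pose G x : 'rV[R]_4 := \row_i ((P i).[x] / q.[x]).
have GE x : q.[x] != 0 -> G x = (q.[x])^-1 *: (std_cubic phi.[x] 1 *m N).
  move=> qx0; rewrite mul_normal_mx std_cubicE !row4E //=.
  apply: row4P; rewrite !coordZ !row4E //= /G !mxE /P !inordK //=.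
  have qxE : q.[x] = g * phi.[x] ^+ 3 + d * phi.[x] ^+ 2 + (k + 2 * b) * phi.[x] + 1.
    by rewrite qE !hornerE /=; ring.
  split; last by rewrite [X in X / _]qxE; ring.
  1-3: by rewrite !hornerE /=; ring.
have Gs := derive1n_row (fun i => smooth_ratfun qn0 (p := P i)).
have e_in : `|0 : R| < e by rewrite normr0.
exists G; split; last 1 first.
- move=> n n3; rewrite Gs.2 //; apply/rowP => i; rewrite !mxE.
  by have [ri PE] := Pcongr i; rewrite (derive1n_ratfun_congr qn0 PE).
- exists e; pose l j := col (inord j) (invmx N).
  have lE x j : (x *m l j) 0 0 = (x *m invmx N)``_j.
    by rewrite mxE [RHS]mxE; apply: eq_bigr => i _; rewrite mxE.
  pose pos (f : 'cV[R]_4) := [set x : 'rV[R]_4 | 0 < (x *m f) 0 0].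
  pose U := pos (l 3%N) `&` (pos (l 2%N - phi.[- e] *: l 3%N) `&` pos (phi.[e] *: l 3%N - l 2%N)).
  have UE x : U x <-> [/\ 0 < (x *m invmx N)``_3,
      phi.[- e] * (x *m invmx N)``_3 < (x *m invmx N)``_2
    & (x *m invmx N)``_2 < phi.[e] * (x *m invmx N)``_3].
    rewrite /U /pos /setI /= !mulmxBr -!scalemxAr.
    have mxB (A B : 'M[R]_1) : (A - B) 0 0 = A 0 0 - B 0 0 by rewrite !mxE.
    have mxZ z (A : 'M[R]_1) : (z *: A) 0 0 = z * A 0 0 by rewrite mxE.
    rewrite !mxB !mxZ !lE !subr_gt0.
    by split=> [[h1 [h2 h3]]|[h1 h2 h3]].
  have YG (t : R) : `|t| < e -> G t *m invmx N = (q.[t])^-1 *: std_cubic phi.[t] 1.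
    by move=> td; rewrite GE ?qn0 // -scalemxAl mulmxK.
  have YG3 (t : R) : `|t| < e -> (G t *m invmx N)``_3 = (q.[t])^-1.
    by move=> td; rewrite YG // coordZ std_cubicE row4E //= expr1n mulr1.
  have YG2 (t : R) : `|t| < e -> (G t *m invmx N)``_2 = (q.[t])^-1 * phi.[t].
    by move=> td; rewrite YG // coordZ std_cubicE row4E //= expr1n mulr1.
  exists U; split => //.
  + exact: Gs.1.
  + move=> t td; apply/eqP => /rowP/(_ (inord 2)).
    rewrite -derive1n1 (Gs.2 1%N) // !mxE derive1n1 derive1E.
    have [_ ->] : is_derive t 1 (fun x => (P (inord 2)).[x] / q.[x]) (D.[t] / q.[t] ^+ 2).
      exact: is_derive_ratfun (P (inord 2)) 1%N _ (qn0 _ td).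
    move/eqP; rewrite mulf_eq0 invr_eq0 expf_eq0 (negPf (qn0 _ td)) orbF.
    by have [_ + _] := rP t (te t td); rewrite lt0r => /andP[/negPf ->].
  + move=> t1 t2 t1e t2e G12; have := YG2 t1 t1e; rewrite G12 YG2 //.
    have := YG3 t1 t1e; rewrite G12 YG3 // => -> /(mulfI _).
    rewrite invr_eq0 qn0 // => /(_ isT) phi12.
    have [t12|t21|//] := ltgtP t1 t2.
      by have := phi_incr _ _ (te _ t1e) (te _ t2e) t12; rewrite phi12 ltxx.
    by have := phi_incr _ _ (te _ t2e) (te _ t1e) t21; rewrite phi12 ltxx.
  + split; first by do 2?apply: openI; exact: open_linear_pos.
    have ler : `|e| < r by rewrite gtr0_norm.
    have lNer : `|- e| < r by rewrite normrN.
    apply/seteqP; split=> [_ [t te' <-]|x [/UE[y30 y2l y2r]]].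
      split.
        apply/UE; rewrite YG3 // YG2 //; have qt0 := qpos t te'.
        move: (te'); rewrite /= ltr_norml => /andP[t1 t2].
        have tr := te _ te'; split; first by rewrite invr_gt0.
          by rewrite mulrC ltr_pM2l ?invr_gt0 // phi_incr.
        by rewrite [X in _ < X]mulrC ltr_pM2l ?invr_gt0 // phi_incr.
      split.
        rewrite mul_delta3 /G mxE /P inordK //= divff //; exact: qn0.
      rewrite GE ?qn0 // cyclic_submoduleZ ?unitfE ?invr_eq0 ?qn0 //.
      by exists phi.[t], 1; split => //; right; exact: oner_neq0.
    move=> /= [+ Kx]; rewrite mul_delta3 => x3.
    have x3E : x``_3 = 1 by move/matrixP/(_ 0 0): x3; rewrite !mxE !mulr1n.
    set y := x *m invmx N in y30 y2l y2r.
    have xE : x = y *m N by rewrite mulmxKV.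
    have y0 : y != 0 by apply: contraTneq y30 => ->; rewrite mxE ltxx.
    move: Kx; rewrite xE => /(cubic_ofP UN y0) [q1 q2 q3].
    have y3n0 : y``_3 != 0 by rewrite gt_eqF.
    have [t tI phit] : exists2 t, t \in `[- e, e] & phi.[t] = y``_2 / y``_3.
      apply: IVT; [lra| by apply: continuous_subspaceT => z; exact: continuous_horner |].
      have h1 : phi.[- e] <= y``_2 / y``_3 by rewrite ler_pdivlMr // ltW.
      have h2 : y``_2 / y``_3 <= phi.[e] by rewrite ler_pdivrMr // ltW.
      by rewrite ge_min le_max h1 h2 orbT.
    have td : `|t| < e.
      rewrite ltr_norml; move: tI; rewrite in_itv /= => /andP[t1 t2].
      rewrite !lt_neqAle t1 t2 !andbT; apply/andP; split.
        apply: contraTneq y2l => te1; rewrite -leNgt.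
        by rewrite te1 phit divfK.
      apply: contraTneq y2r => te1; rewrite -leNgt.
      by rewrite -te1 phit divfK.
    exists t => //; rewrite GE ?qn0 //.
    have y2E : y``_2 = phi.[t] * y``_3 by rewrite phit divfK.
    have y1E : y``_1 = phi.[t] ^+ 2 * y``_3.
      by apply: (mulIf y3n0); rewrite q2 y2E; ring.
    have y0E : y``_0 = phi.[t] ^+ 3 * y``_3.
      by apply: (mulIf y3n0); rewrite q3 y1E y2E; ring.
    have yE : y = y``_3 *: std_cubic phi.[t] 1.
      rewrite std_cubicE; apply: row4P; rewrite !coordZ !row4E //= y0E y1E y2E.
      by split; ring.
    have G3 : (G t)``_3 = 1 by rewrite /G mxE /P inordK //= divff // qn0.
    suff -> : (q.[t])^-1 = y``_3 by rewrite scalemxAl -yE.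
    have y3S : y``_3 * (std_cubic phi.[t] 1 *m N)``_3 = 1.
      by rewrite -coordZ scalemxAl -yE -xE.
    have qS : (q.[t])^-1 * (std_cubic phi.[t] 1 *m N)``_3 = 1.
      by rewrite -coordZ -GE ?qn0.
    by rewrite -[LHS]mulr1 -y3S mulrCA qS mulr1.
- have -> : G 0 = delta_mx 0 ord_max; last by [].
  rewrite GE ?qn0 // q0 invr1 scale1r phi0 mul_normal_mx std_cubicE !row4E //=.
  apply: row4P; rewrite !row4E //= !mxE -!val_eqE /= !inordK //=.
  by split; ring.
Qed.

End CanonicalJet.

(** * Contact of third order *)

(** The 3-jets of two parametrizations in contact satisfy the same two equations,
    in which [m] and [k] occur linearly with a common nonzero factor.  Conversely
    the chart X3 = 1 serves both curves, because the canonical 3-jet depends on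
    [m] and [k] only. *)
Lemma contact_iff_invariants (R : realType) (m k a b d g m' k' a' b' d' g' : R) :
  m != 0 -> m' != 0 ->
  contact 3 (cubic_of (normal_mx m k a b d g)) (cubic_of (normal_mx m' k' a' b' d' g'))
    (point_f R) <-> m = m' /\ k = k'.
Proof.
move=> m0 m'0; split; last first.
  move=> [<- <-].
  have [G [locG G0 jetG]] := canonical_parametrization k a b d g m0.
  have [G' [locG' G'0 jetG']] := canonical_parametrization k a' b' d' g' m0.
  exists (delta_mx (inord 3) 0), G, G'; split => // n n3.
  by rewrite jetG // jetG'.
move=> [w [g1 [g2 [loc1 loc2 g10 g20 jets]]]].
have [nz m3 k3] := jet_invariants m0 erefl loc1 g10.
have [_ m3' k3'] := jet_invariants m'0 erefl loc2 g20.
move: m3' k3'; rewrite -!jets // m3 k3 => /(mulIf _) mm /(mulIf _) kk.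
by split; [apply: oppr_inj; apply: mm|apply: kk]; rewrite mulf_neq0 // pnatr_eq0.
Qed.

Theorem theorem5 (R : realType) (C C' : set (set 'rV[LL R]_2))
    (chainC : is_chain C) (chainC' : is_chain C')
    (parC : cubic_parabola (proper_part C))
    (parC' : cubic_parabola (proper_part C'))
    (Cplus C'plus : set (set 'rV[R]_4))
    (extC : cubic_extension (proper_part C) Cplus)
    (extC' : cubic_extension (proper_part C') C'plus) :
  (exists p : set 'rV[LL R]_2, [/\ is_improper p, C p & C' p]) <->
  contact 3 Cplus C'plus (point_f R).
Proof.
have [v [m [c [v0 m0 c0 CE]]]] := chain_normal_form chainC.
have [v' [m' [c' [v'0 m'0 c'0 C'E]]]] := chain_normal_form chainC'.
have [cubK K_ext] := extC; have [cubK' K'_ext] := extC'.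
have K_curve t : Cplus (embed (affine_curve v m c t)).
  by apply: K_ext; exists (affine_curve v m c t) => //; rewrite CE; exact: proper_part_affine_curve.
have K'_curve t : C'plus (embed (affine_curve v' m' c' t)).
  by apply: K'_ext; exists (affine_curve v' m' c' t) => //; rewrite C'E; exact: proper_part_affine_curve.
have m10 := affine_curve_nonplanar cubK K_curve.
have m'10 := affine_curve_nonplanar cubK' K'_curve.
rewrite (cubic_extension_normal cubK K_curve) (cubic_extension_normal cubK' K'_curve).
rewrite contact_iff_invariants //.
have invE : m`_1 = m'`_1 /\ (m`_2 - v`_1 * m`_1) / m`_1 = (m'`_2 - v'`_1 * m'`_1) / m'`_1 <->
    m`_1 = m'`_1 /\ m`_2 - v`_1 * m`_1 = m'`_2 - v'`_1 * m'`_1.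
  split=> -[e1 e2]; split=> //; last by rewrite e2 e1.
  by move: e2; rewrite -e1 => /(mulIf _); apply; rewrite invr_eq0.
rewrite invE -improper_point_eq //; split=> [[p [imp Cp C'p]]|e].
  rewrite -(normal_chain_improper m0 imp (v := v) (c := c)) -?CE //.
  by rewrite (normal_chain_improper m'0 imp (v := v') (c := c')) -?C'E.
exists (cyclic_submodule (vec2 v m)).
have [imp Cp] := normal_chain_has_improper c v0 m0.
have [_ C'p] := normal_chain_has_improper c' v'0 m'0.
by split => //; [rewrite CE | rewrite e C'E].
Qed.
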